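(* Let $q$ be a prime power, let $\mathbb{F}_q$ be the finite field with $q$ elements, let $W$ be an $n$-dimensional vector space over $\mathbb{F}_q$, and let $u,v$ be nonnegative integers. Let $\mathcal{S}=\{(U_i,V_i):1\le i\le m\}$ be a system of pairs of subspaces of $W$ such that (i) $\dim(U_i)=u$ and $\dim(V_i)=v$ for each $1\le i\le m$; (ii) $U_i\cap V_i=\{0\}$ for each $1\le i\le m$; (iii) for all $i\ne j$ ($1\le i,j\le m$), $U_i\cap V_j\ne\{0\}$ or $U_j\cap V_i\ne\{0\}$. Then $$m\le \left(\frac{q}{q-1}\right)^n q^{uv}.$$ *)

(* Defs.v *)
From HB Require Import structures.
From mathcomp Require Export all_boot all_order all_algebra.

(* Main.v *)
(** For a linear map [M] from [W] to [F^v], let [E i] be the event that [M]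
    vanishes on [U i] and is injective on [V i]. If [M] lies in [E i] and
    [E j], then [ker M] contains [U i] and [U j] and meets both [V i] and [V j]
    trivially, so the cross-intersection hypothesis forces [i = j]: the events
    are disjoint. Each event has at least [#|GL_v| * q^((n - u - v) v)] elements
    among the [q^(n v)] linear maps, and
    [#|GL_v| >= q^(v^2) (1 - 1/q)^v], which gives the bound. *)
Require Import Defs.
From mathcomp Require Import all_boot all_order all_algebra.
From mathcomp Require Import zify.
Set Implicit Arguments.
Unset Strict Implicit.
Unset Printing Implicit Defensive.
Import Order.TTheory GRing.Theory Num.Theory VectorInternalTheory.
Local Open Scope ring_scope.

(** Each factor satisfies q^i - 1 >= q^(i-1) (q - 1). The right side is the order of GL_v over a
    field of q elements, times q^v to clear the denominators of (1 - 1/q)^v. *)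
Lemma leq_card_GL_formula (q v : nat) :
  (q ^ (v * v) * q.-1 ^ v <=
   q ^ 'C(v, 2) * \prod_(1 <= i < v.+1) (q ^ i - 1) * q ^ v)%N.
Proof.
elim: v => [|v IHv]; first by rewrite big_nil.
rewrite big_nat_recr //= binS bin1.
set P := \prod_(1 <= i < v.+1) _ in IHv *.
have le_factor : (q ^ v * q.-1 <= q ^ v.+1 - 1)%N.
  case: q {IHv P} => [|q]; first by rewrite muln0.
  by rewrite /= expnSr; have := expn_gt0 q.+1 v; nia.
apply: leq_trans (_ : q ^ (v * v) * q.-1 ^ v * (q ^ v * q ^ v.+1 * q.-1) <= _)%N.
  have -> : (v.+1 * v.+1 = v * v + (v + v.+1))%N by lia.
  by rewrite 2!expnD (expnSr q.-1); apply: eq_leq; lia.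
apply: leq_trans (leq_mul IHv (leqnn _)) _.
have -> : (q ^ 'C(v, 2) * P * q ^ v * (q ^ v * q ^ v.+1 * q.-1) =
  q ^ 'C(v, 2) * P * q ^ v * q ^ v.+1 * (q ^ v * q.-1))%N by lia.
apply: leq_trans (leq_mul (leqnn _) le_factor) _.
by rewrite expnD; apply: eq_leq; lia.
Qed.

Lemma leq_card_unitmx (F : finFieldType) (v : nat) :
  (#|F| ^ (v * v) * #|F|.-1 ^ v <= #|[set G : 'M[F]_v | G \in unitmx]| * #|F| ^ v)%N.
Proof.
(* [card_GL] requires positive size, so size 0 is treated by hand: the identity matrix is a unit. *)
case: v => [|v].
  rewrite !muln1 card_gt0; apply/set0Pn; exists 1%:M.
  by rewrite inE unitmx1.
apply: leq_trans (leq_card_GL_formula _ _) _.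
by rewrite -card_GL // cardsT card_sub cardsE.
Qed.

Lemma leq_card_mx_kill_free (F : finFieldType) (N a b : nat)
    (A : 'M[F]_(a, N)) (B : 'M[F]_(b, N)) :
  row_free (col_mx A B) ->
  (#|[set G : 'M[F]_b | G \in unitmx]| * #|F| ^ ((N - (a + b)) * b) <=
   #|[set M : 'M[F]_(N, b) | (A *m M == 0%R) && row_free (B *m M)]|)%N.
Proof.
move=> freeC; set C := col_mx A B in freeC *.
have [K freeK CK] : exists2 K : 'M_(\rank (kermx C^T), N),
    row_free K & C *m K^T = 0.
  exists (row_base (kermx C^T)); first exact: row_base_free.
  apply: trmx_inj; rewrite trmx_mul trmxK trmx0.
  by apply/sub_kermxP; rewrite eq_row_base.
(* All solutions of [C *m M = col_mx 0 G]: a particular one from the right inverse [pinvmx C], plus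
   [K^T *m H] for arbitrary [H], which [C] annihilates. [G] is recovered by applying [C], then [H]
   because [K] has free rows. *)
pose f (GH : 'M[F]_b * 'M_(\rank (kermx C^T), b)) :=
  pinvmx C *m col_mx 0 GH.1 + K^T *m GH.2.
have Cf GH : C *m f GH = col_mx 0 GH.1.
  by rewrite mulmxDr (mulmxA C (pinvmx C)) mulmxVp // (mulmxA C) CK mul1mx mul0mx addr0.
have f_inj : injective f.
  move=> [G H] [G' H'] eq_f.
  have := Cf (G, H); rewrite eq_f Cf => /eq_col_mx[_ /= eqG].
  move: eq_f; rewrite /f /= eqG => /addrI /(congr1 trmx).
  rewrite !trmx_mul !trmxK => eqH; congr (_, _); apply: trmx_inj.
  exact: (row_free_inj freeK eqH).
have -> : (N - (a + b) = \rank (kermx C^T))%N.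
  by rewrite mxrank_ker mxrank_tr; move/eqP: freeC => ->.
rewrite -card_mx -cardsT -cardsX -(card_imset _ f_inj).
apply/subset_leq_card/subsetP => _ /imsetP[[G H] + ->].
rewrite !inE /= andbT => unitG.
have := Cf (G, H); rewrite mul_col_mx => /eq_col_mx[-> ->] /=.
by rewrite eqxx row_free_unit.
Qed.

Lemma leq_card_mx_kill_inj (F : finFieldType) (N a b v : nat)
    (A : 'M[F]_(a, N)) (B : 'M[F]_(b, N)) :
  \rank B = v -> (A :&: B)%MS = 0 ->
  (#|[set G : 'M[F]_v | G \in unitmx]| * #|F| ^ ((N - (\rank A + v)) * v) <=
   #|[set M : 'M[F]_(N, v) | (A *m M == 0%R) && (\rank (B *m M) == v)]|)%N.
Proof.
move=> <- AB0.
have /leq_card_mx_kill_free le_card : row_free (col_mx (row_base A) (row_base B)).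
  rewrite /row_free -addsmxE (adds_eqmx (eq_row_base A) (eq_row_base B)).
  by rewrite mxrank_disjoint_sum.
apply: leq_trans le_card _; apply/subset_leq_card/subsetP => M.
rewrite !inE /row_free (eqmxMr _ (eq_row_base B)) => /andP[/eqP A0 ->].
by rewrite andbT -submx0 -(eqmxMr _ (eq_row_base A)) A0 submx0.
Qed.

(** By rank-nullity, preserving the rank of [B] means that the kernel of [M] meets the row space of
    [B] trivially; this kernel contains [A]. *)
Lemma capmx_kill_inj (F : fieldType) (N a b p : nat)
    (A : 'M[F]_(a, N)) (B : 'M[F]_(b, N)) (M : 'M[F]_(N, p)) :
  A *m M = 0 -> \rank (B *m M) = \rank B -> (A :&: B)%MS = 0.
Proof.
move=> /sub_kermxP sAK rBM; apply/eqP; rewrite capmxC -submx0.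
apply: submx_trans (capmxS (submx_refl B) sAK) _.
by rewrite submx0 -mxrank_eq0 -(eqn_add2l (\rank (B *m M))) mxrank_mul_ker rBM addn0.
Qed.

Lemma capv_eq0_mx (F : fieldType) (W : vectType F) (U V : {vspace W}) :
  (U :&: V == 0)%VS = ((vs2mx U :&: vs2mx V)%MS == 0).
Proof. by rewrite -dimv_eq0 -mxrank_eq0 /capv /dimv mx2vsK. Qed.

Lemma cross_pairs_mul_card_bound (F : finFieldType) (W : vectType F) (u v m : nat)
    (U V : 'I_m -> {vspace W}) :
  (forall i, \dim (U i) = u /\ \dim (V i) = v) ->
  (forall i, (U i :&: V i)%VS = 0%VS) ->
  (forall i j, i <> j ->
     (U i :&: V j)%VS <> 0%VS \/ (U j :&: V i)%VS <> 0%VS) ->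
  (m * (#|[set G : 'M[F]_v | G \in unitmx]| *
        #|F| ^ ((\dim {:W} - (u + v)) * v)) <= #|F| ^ (\dim {:W} * v))%N.
Proof.
move=> hdim hdisj hcross; rewrite dimvf.
pose E i := [set M : 'M[F]_(dim W, v) |
  (vs2mx (U i) *m M == 0) && (\rank (vs2mx (V i) *m M) == v)].
have rankU i : \rank (vs2mx (U i)) = u by case: (hdim i).
have rankV i : \rank (vs2mx (V i)) = v by case: (hdim i).
have disjE i j : i != j -> [disjoint E i & E j].
  move=> /eqP neq_ij; rewrite -setI_eq0; apply/set0Pn => -[M].
  rewrite !inE => /andP[/andP[/eqP Ui0 /eqP rVi] /andP[/eqP Uj0 /eqP rVj]].
  (* The same [M] refutes both alternatives: it kills [U i] and is injective on [V j], and also with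
     [i] and [j] exchanged. *)
  by case: (hcross i j neq_ij); apply; apply/eqP; rewrite capv_eq0_mx;
    apply/eqP; apply: (@capmx_kill_inj _ _ _ _ _ _ _ M); rewrite ?rankV.
have cardE i : (#|[set G : 'M[F]_v | G \in unitmx]| *
    #|F| ^ ((dim W - (u + v)) * v) <= #|E i|)%N.
  rewrite -(rankU i); apply: leq_card_mx_kill_inj => //.
  by apply/eqP; rewrite -capv_eq0_mx hdisj.
rewrite -(card_mx F (dim W) v) -{1}(card_ord m) -(sum_nat_const 'I_m).
apply: leq_trans (_ : \sum_i #|E i| <= _)%N; first exact: leq_sum.
under eq_bigr do rewrite -sum1_card.
by rewrite -partition_disjoint_bigcup ?sum1_card ?max_card.
Qed.

Lemma cross_pairs_nat_bound (F : finFieldType) (W : vectType F) (u v m : nat)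
    (U V : 'I_m -> {vspace W}) :
  (forall i, \dim (U i) = u /\ \dim (V i) = v) ->
  (forall i, (U i :&: V i)%VS = 0%VS) ->
  (forall i j, i <> j ->
     (U i :&: V j)%VS <> 0%VS \/ (U j :&: V i)%VS <> 0%VS) ->
  (m * #|F|.-1 ^ \dim {:W} <= #|F| ^ \dim {:W} * #|F| ^ (u * v))%N.
Proof.
(* With at least one pair, [u + v] is at most the dimension, so the subtraction in the exponent is
   not truncated. *)
case: m U V => // m U V hdim hdisj hcross.
have le_uvn : (u + v <= \dim {:W})%N.
  have [<- <-] := hdim ord0.
  by rewrite -dimv_disjoint_sum ?hdisj // dimvS ?subvf.
have le_card := cross_pairs_mul_card_bound hdim hdisj hcross.
have le_unit := leq_card_unitmx F v.
have := card_finNzRing_gt1 F; move: le_card le_unit le_uvn.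
move: #|[set _ | _]| #|F| (\dim {:W}) => g q n le_card le_unit le_uvn q_gt1.
set r := (n - (u + v))%N in le_card.
have defn : (n = r + (u + v))%N by rewrite /r subnK.
(* Since n v = r v + u v + v^2, cancelling q^(r v) q^(v^2) leaves m <= q^(u v) (q/(q-1))^v, with
   denominators cleared. *)
have le_v : (m.+1 * q.-1 ^ v <= q ^ (u * v) * q ^ v)%N.
  have q_gt0 : (0 < q ^ (r * v) * q ^ (v * v))%N by rewrite muln_gt0 !expn_gt0 ltnW.
  rewrite -(leq_pmul2l q_gt0).
  apply: leq_trans (_ : m.+1 * (g * q ^ (r * v)) * q ^ v <= _)%N.
    by have := leq_mul (leqnn (m.+1 * q ^ (r * v))) le_unit; lia.
  apply: leq_trans (leq_mul le_card (leqnn _)) _.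
  by rewrite {1}defn !mulnDl !expnD; apply: eq_leq; lia.
have -> : n = (v + (r + u))%N by lia.
(* The remaining n - v = r + u factors q/(q-1) are at least 1, which raises the exponent from v to
   n. *)
have le_pred : (q.-1 ^ (r + u) <= q ^ (r + u))%N.
  by case: (r + u)%N => // k; rewrite leq_exp2r ?leq_pred.
rewrite 2!(expnD _ v) mulnA; apply: leq_trans (leq_mul le_v le_pred) _.
by apply: eq_leq; lia.
Qed.

Theorem theorem1p10 (q : nat) (F : finFieldType) (hq : #|F| = q)
    (n : nat) (W : vectType F) (hW : \dim {:W} = n)
    (u v m : nat) (U V : 'I_m -> {vspace W})
    (hdim : forall i : 'I_m, \dim (U i) = u /\ \dim (V i) = v)
    (hdisj : forall i : 'I_m, (U i :&: V i)%VS = 0%VS)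
    (hcross : forall i j : 'I_m, i <> j ->
       (U i :&: V j)%VS <> 0%VS \/ (U j :&: V i)%VS <> 0%VS) :
  (m%:R : rat) <= (q%:R / (q%:R - 1)) ^+ n * q%:R ^+ (u * v).
Proof.
have q_gt1 : (1 < q)%N by rewrite -hq card_finNzRing_gt1.
have := cross_pairs_nat_bound hdim hdisj hcross; rewrite hq hW => le_nat.
have q1 : (q%:R - 1 : rat) = q.-1%:R by rewrite -subn1 natrB // ltnW.
rewrite q1 expr_div_n mulrAC ler_pdivlMr; first by rewrite -!natrX -!natrM ler_nat.
by rewrite exprn_gt0 // ltr0n -ltnS prednK // ltnW.
Qed.
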